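(* Let $\mathbb{F}$ be a finite field, $n\ge1$ with $\mathrm{char}(\mathbb{F})\nmid n$, $A=\mathbb{F}[x]/\langle x^n-1\rangle$, $\sigma\in\mathrm{Aut}_{\mathbb{F}}(A)$, and let $E$ be the set of primitive idempotents of $A$. Let $S\subset E$ be a nonempty subset and $b\ge1$ an integer such that $S\cap\sigma^j(S)=\varnothing$ for all $1\le j\le b$. Put $c:=\sum_{\varepsilon\in S}\varepsilon$, $k:=\dim_{\mathbb{F}}\langle c\rangle$, let $1\le m\le b$, let $G_\nu\in\mathbb{F}^{k\times n}$ be the matrix with rows $\mathfrak{v}(\sigma^\nu(c)),\mathfrak{v}(\sigma^\nu(xc)),\ldots,\mathfrak{v}(\sigma^\nu(x^{k-1}c))$, let $G:=\sum_{\nu=0}^m z^\nu G_\nu\in\mathbb{F}[z]^{k\times n}$ and $\mathcal{C}:=\mathrm{im}\,G$. For $0\le\mu\le\nu\le b$ let $\mathcal{C}_{\mu,\nu}\subseteq\mathbb{F}^n$ be the block code spanned by all rows of $G_\mu,G_{\mu+1},\ldots,G_\nu$. Assume that there are numbers $d_\nu$ such that $\mathrm{dist}(\mathcal{C}_{\mu,\mu+\nu})=d_\nu$ for all $0\le\mu\le\mu+\nu\le b$. Define $$D(t):=\begin{cases}2\sum_{\nu=0}^{t-1}d_\nu+(m-t+1)d_t,& t=0,\ldots,m,\\[1ex] 2\sum_{\nu=0}^{m-1}d_\nu+(t-m+1)d_m,& t\ge m+1.\end{cases}$$ Then $\hat d^{\,r}_j\ge D(j-m-1)$ for all $j\ge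 m+1$, and $\mathrm{dist}(\mathcal{C})\ge\min\{D(0),D(1),\ldots,D(m)\}$.
   Context: Primitive idempotents: $x^n-1=\prod_{i=0}^{r-1}\pi_i$ with pairwise distinct monic irreducible $\pi_i\in\mathbb{F}[x]$; $\varepsilon^{(i)}\in A$ is the unique element with $\varepsilon^{(i)}\equiv\delta_{ij}\bmod\pi_j$ for all $j$, and $E=\{\varepsilon^{(0)},\dots,\varepsilon^{(r-1)}\}$, which is permuted by every $\mathbb{F}$-algebra automorphism $\sigma$ of $A$. $\langle c\rangle$ is the ideal of $A$ generated by $c$. The map $\mathfrak{v}:A\to\mathbb{F}^n$ is the coefficient map $\sum_{i=0}^{n-1}v_ix^i\mapsto(v_0,\dots,v_{n-1})$. For $G\in\mathbb{F}[z]^{k\times n}$, $\mathrm{im}\,G=\{uG\mid u\in\mathbb{F}[z]^k\}$. For $v=\sum_jv_jz^j\in\mathbb{F}[z]^n$ with $v_j\in\mathbb{F}^n$, $\mathrm{wt}(v)=\sum_j\mathrm{wt}(v_j)$ with the Hamming weight on $\mathbb{F}^n$. The distance $\mathrm{dist}$ of a code (in $\mathbb{F}^n$ or $\mathbb{F}[z]^n$) is the minimum weight of its nonzero elements. The matrix $G$ is a minimal right-invertible matrix all of whose row degrees equal $m$. For such a code the $j$th extended row distance ($j\ge m+1$) is $$\hat d^{\,r}_j:=\min\{\mathrm{wt}(uG)\mid u\in\mathbb{F}[z]^k,\ u_0\ne0,\ \deg u=j-m-1,\ \text{no } m \text{ consecutive coefficients of } u \text{ are zero}\},$$ where $u=\sum_{i=0}^{j-m-1}u_iz^i$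 with $u_i\in\mathbb{F}^k$, and the condition on consecutive coefficients refers to $u_0,\dots,u_{j-m-1}$. *)

(* Defs.v *)
From mathcomp Require Import all_boot all_order all_algebra all_field.
From mathcomp Require Import boolp.

Set Implicit Arguments.
Unset Strict Implicit.
Unset Printing Implicit Defensive.

Import GRing.Theory.
Local Open Scope ring_scope.

(* The minimum of a set of natural numbers; the empty set gets the junk value
   0, so that a positive lower bound on [minnat P] forces [P] to be inhabited. *)
Definition minnat (P : nat -> Prop) : nat :=
  if pselect (exists n, `[< P n >]) is left exP then ex_minn exP else 0%N.

Definition dist (T : zmodType) (wt : T -> nat) (C : T -> Prop) : nat :=
  minnat (fun w => exists v : T, [/\ C v, v != 0 & wt v = w]).

Section Weights.
Variables (F : finFieldType) (n : nat).

Definition hamming_wt (v : 'rV[F]_n) : nat := #|[set i | v 0 i != 0]|.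

(* Elements of F[z]^n are row vectors of polynomials: [coefv j v] is the
   coefficient of z^j, and [sizev v] is 1 + deg v (and 0 for v = 0). *)
Definition coefv (j : nat) (v : 'rV[{poly F}]_n) : 'rV[F]_n :=
  map_mx (coefp j) v.

Definition sizev (v : 'rV[{poly F}]_n) : nat :=
  (\max_(i < n) size (v 0 i)%R)%N.

Definition poly_wt (v : 'rV[{poly F}]_n) : nat :=
  (\sum_(j < sizev v) hamming_wt (coefv j v))%N.

End Weights.

Notation cyclic_alg F n := {poly %/ ('X^n - 1 : {poly F})}.

Section CyclicAlgebra.
Variables (F : finFieldType) (n : nat).
Local Notation A := (cyclic_alg F n).

Definition primitive_idempotent (e : A) : Prop :=
  exists (r : nat) (pi : 'I_r -> {poly F}) (i : 'I_r),
    [/\ forall j, irreducible_poly (pi j) /\ pi j \is monic,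
        injective pi,
        'X^n - 1 = \prod_(j < r) pi j &
        forall j, pi j %| (e : {poly F}) - (i == j)%:R].

(* The set of all multiples of c is already an F-subspace; the span only turns
   it into a [{vspace A}]. *)
Definition principal_ideal (c : A) : {vspace A} :=
  <<codom (fun a : A => (a * c)%R)>>%VS.

Definition coef_vec (a : A) : 'rV[F]_n := \row_(i < n) (a : {poly F})`_i.

Definition gen_coef (sigma : A -> A) (c : A) (k nu : nat) : 'M[F]_(k, n) :=
  \matrix_(i < k) coef_vec (iter nu sigma ('qX ^+ i * c)).

Definition gen_mx (sigma : A -> A) (c : A) (k m : nat) : 'M[{poly F}]_(k, n) :=
  \sum_(nu < m.+1) 'X^nu *: map_mx polyC (gen_coef sigma c k nu).

Definition block_code (sigma : A -> A) (c : A) (k mu nu : nat)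
    (v : 'rV[F]_n) : Prop :=
  (v <= \sum_(mu <= l < nu.+1) <<gen_coef sigma c k l>>)%MS.

End CyclicAlgebra.

Section ConvolutionalCode.
Variables (F : finFieldType) (k n : nat).

Definition conv_code (G : 'M[{poly F}]_(k, n)) (v : 'rV[{poly F}]_n) : Prop :=
  exists u : 'rV[{poly F}]_k, v = u *m G.

(* [ext_row_dist m G j] is meant for j >= m + 1, when [j - m] = 1 + (j-m-1) is
   the number of coefficients of a polynomial of degree j-m-1. *)
Definition ext_row_dist (m : nat) (G : 'M[{poly F}]_(k, n)) (j : nat) : nat :=
  minnat (fun w => exists u : 'rV[{poly F}]_k,
    [/\ coefv 0 u != 0,
        sizev u = (j - m)%N,
        forall i, (i + m <= j - m)%N ->
          exists2 l, (l < m)%N & coefv (i + l) u != 0 &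
        poly_wt (u *m G) = w]).

End ConvolutionalCode.

Definition Dbound (d : nat -> nat) (m t : nat) : nat :=
  if (t <= m)%N then (2 * (\sum_(nu < t) d nu) + (m - t + 1) * d t)%N
  else (2 * (\sum_(nu < m) d nu) + (t - m + 1) * d m)%N.

(* Main.v *)
(* The idempotents in S, sigma(S), ..., sigma^b(S) are pairwise orthogonal, and
   p c = 0 with deg p < dim <c> forces p = 0; hence the rows of G_0, ..., G_m
   are jointly linearly independent.  So, for a message u of degree N, the
   coefficient of z^t in u G is a word of C_(max(0,t-N), min(t,m)) that is
   nonzero as soon as one of the u_i contributing to it is.  When u_0 and u_N
   are nonzero and u has no m consecutive zero coefficients this holds for all
   t <= N + m, and the corresponding distances d_nu add up to D(N). *)

Require Import Defs.
From mathcomp Require Import all_boot all_order all_algebra all_field.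
From mathcomp Require Import boolp zify.

Set Implicit Arguments.
Unset Strict Implicit.
Unset Printing Implicit Defensive.

Import GRing.Theory.
Local Open Scope ring_scope.

(** * Minima of natural numbers, and [Dbound] as a sum over coefficients *)

Lemma minnat_ge (P : nat -> Prop) (B : nat) :
  (exists w, P w) -> (forall w, P w -> (B <= w)%N) -> (B <= minnat P)%N.
Proof.
move=> [w Pw] PB; rewrite /minnat; case: pselect => [exP|[]].
  by case: ex_minnP => v /asboolP /PB.
by exists w; apply/asboolP.
Qed.

Lemma minnat_le (P : nat -> Prop) (w : nat) : P w -> (minnat P <= w)%N.
Proof.
move=> Pw; rewrite /minnat; case: pselect => [exP|//].
by case: ex_minnP => v _; apply; apply/asboolP.
Qed.

Lemma bigminn_le (I : eqType) (r : seq I) (x : nat) (f : I -> nat) (i : I) :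
  i \in r -> (\big[minn/x]_(t <- r) f t <= f i)%N.
Proof.
elim: r => // t r IHr; rewrite inE big_cons geq_min => /predU1P[->|/IHr->].
  by rewrite leqnn.
exact: orbT.
Qed.

(** The index climbs through 0, ..., a-1, stays at a for B-a+1 values of t, then descends
    symmetrically. *)
Lemma sum_trapezoid (d : nat -> nat) (a B : nat) : (a <= B)%N ->
  (\sum_(t < (a + B).+1) d (minn (minn t a) (a + B - t)) =
   2 * (\sum_(t < a) d t) + (B - a + 1) * d a)%N.
Proof.
move=> leaB.
rewrite -(big_mkord xpredT (fun t => d (minn (minn t a) (a + B - t)))).
rewrite (big_cat_nat (n := a)) //=; last by lia.
rewrite (big_cat_nat (m := a) (n := B.+1)) //=; [|lia|lia].
have -> : (\sum_(0 <= t < a) d (minn (minn t a) (a + B - t)) =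
           \sum_(t < a) d t)%N.
  rewrite big_mkord; apply: eq_bigr => t _; congr d; have := ltn_ord t; lia.
have -> : (\sum_(a <= t < B.+1) d (minn (minn t a) (a + B - t)) =
           (B - a + 1) * d a)%N.
  rewrite (eq_big_nat _ _ (F2 := fun=> d a)) ?sum_nat_const_nat.
    by congr muln; lia.
  by move=> t tP; congr d; lia.
suff -> : (\sum_(B.+1 <= t < (a + B).+1) d (minn (minn t a) (a + B - t)) =
           \sum_(t < a) d t)%N by rewrite addnCA addnn -mul2n addnC.
rewrite -{1}[B.+1]add0n big_addn (_ : (a + B).+1 - B.+1 = a)%N; last by lia.
rewrite big_nat_rev /= big_mkord; apply: eq_bigr => t _; congr d.
have := ltn_ord t; lia.
Qed.

(** For a message of degree N, the coefficient of z^t involves the blocks G_nu with max(0,t-N) <= nu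
    <= min(t,m); the index of [d] is the number of these blocks minus one. The two branches of
    [Dbound] are the trapezoids with a = min(N,m) and B = max(N,m). *)
Lemma DboundE (d : nat -> nat) (m N : nat) :
  Dbound d m N = (\sum_(t < (N + m).+1) d (minn t m - (t - N)))%N.
Proof.
rewrite /Dbound; case: leqP => [leNm|ltmN].
  rewrite -sum_trapezoid //; apply: eq_bigr => t _; congr d.
  by have := ltn_ord t; lia.
rewrite -sum_trapezoid 1?ltnW // addnC; apply: eq_bigr => t _; congr d.
by have := ltn_ord t; lia.
Qed.

(** * Coefficients and weights of polynomial vectors *)

Section PolynomialVectors.
Variables (F : finFieldType) (n : nat).
Implicit Types (v : 'rV[{poly F}]_n).

Lemma coefv_eq0 v j : (sizev v <= j)%N -> coefv j v = 0.
Proof.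
move=> vj; apply/rowP=> i; rewrite !mxE /= nth_default //.
apply: leq_trans vj; exact: (leq_bigmax (F := fun i => size (v 0 i)) i).
Qed.

Lemma coefv_lead v N : sizev v = N.+1 -> coefv N v != 0.
Proof.
move=> vN; apply/negP => /eqP /rowP vN0.
suff: (sizev v <= N)%N by rewrite vN ltnn.
apply/bigmax_leqP => i _; apply/leq_sizeP => j.
rewrite leq_eqVlt => /predU1P[<-|ltNj].
  by have := vN0 i; rewrite !mxE.
rewrite nth_default // (leq_trans _ ltNj) // -vN.
exact: (leq_bigmax (F := fun i => size (v 0 i)) i).
Qed.

Lemma coefv_neq0 v : v != 0 -> exists j, coefv j v != 0.
Proof.
move=> v0; apply: contrapT => H; case/eqP: v0; apply/rowP => i.
rewrite mxE; apply/polyP => j; rewrite coef0.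
have [/rowP/(_ i)|cj] := eqVneq (coefv j v) 0; first by rewrite !mxE.
by case: H; exists j.
Qed.

Lemma sum_wt_le v s K :
  (\sum_(t < K) hamming_wt (coefv (s + t) v) <= poly_wt v)%N.
Proof.
pose f j := hamming_wt (coefv j v).
have -> : (\sum_(t < K) f (s + t) = \sum_(s <= j < s + K) f j)%N.
  rewrite [RHS](_ : _ = \sum_(0 + s <= j < s + K) f j)%N //.
  rewrite big_addn addKn big_mkord.
  by apply: eq_bigr => t _; rewrite addnC.
have f0 j : (sizev v <= j)%N -> f j = 0%N.
  move=> /coefv_eq0 vj; rewrite /f vj; apply: eq_card0 => i.
  by rewrite inE mxE eqxx.
rewrite /poly_wt -(big_mkord xpredT f).
(* A common range containing both sums; the terms from [sizev v] on are zero. *)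
apply: (@leq_trans (\sum_(0 <= j < s + K + sizev v) f j)).
  rewrite [leqRHS](big_cat_nat (n := s)) //=; last by lia.
  rewrite [X in (_ <= _ + X)%N](big_cat_nat (n := s + K)) //=; lia.
rewrite (big_cat_nat (n := sizev v)) //=; last by lia.
rewrite [X in (_ + X)%N]big_nat [X in (_ + X)%N]big1 ?addn0 // => j.
by case/andP => /f0.
Qed.

End PolynomialVectors.

(** * Weight bounds for convolutional codes with jointly independent blocks *)

Section ConvolutionalBounds.
Variables (F : finFieldType) (k n m : nat) (G : nat -> 'M[F]_(k, n)).
Variable d : nat -> nat.
Hypothesis k_gt0 : (0 < k)%N.
Hypothesis m_gt0 : (0 < m)%N.
(** Independence of the blocks and the distances of their spans are all that is kept of the cyclic
    structure in this section. *)
Hypothesis G_indep : forall w : nat -> 'rV[F]_k,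
  \sum_(nu < m.+1) w nu *m G nu = 0 -> forall nu, (nu <= m)%N -> w nu = 0.
Hypothesis wt_ge : forall mu nu (v : 'rV[F]_n), (mu + nu <= m)%N -> v != 0 ->
  (v <= \sum_(mu <= l < (mu + nu).+1) <<G l>>)%MS -> (d nu <= hamming_wt v)%N.

Let Gz : 'M[{poly F}]_(k, n) := \sum_(nu < m.+1) 'X^nu *: map_mx polyC (G nu).

(** The conditional guards against truncated subtraction, which would read [coefv 0 u] when nu >
    t. *)
Lemma coefv_mulmx (u : 'rV[{poly F}]_k) t :
  coefv t (u *m Gz) =
    \sum_(nu < m.+1) (if (nu <= t)%N then coefv (t - nu) u else 0) *m G nu.
Proof.
rewrite mulmx_sumr; apply/rowP => j; rewrite mxE /= summxE coef_sum summxE.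
apply: eq_bigr => nu _; rewrite -scalemxAr !mxE coefXnM ltnNge.
case: leqP => [_|_] /=; last by rewrite big1 // => i _; rewrite mxE mul0r.
by rewrite coef_sum; apply: eq_bigr => i _; rewrite !mxE coefMC.
Qed.

Lemma coefv_mulmx_neq0 (u : 'rV[{poly F}]_k) t nu :
  (nu <= m)%N -> (nu <= t)%N -> coefv (t - nu) u != 0 ->
  coefv t (u *m Gz) != 0.
Proof.
move=> nu_m nu_t; apply: contraNN => /eqP.
rewrite coefv_mulmx.
pose w i := if (i <= t)%N then coefv (t - i) u else 0.
by move=> /(@G_indep w)/(_ nu nu_m); rewrite /w nu_t => ->.
Qed.

(** The first two hypotheses make the codeword coefficients s, ..., s+N+m depend only on the message
    coefficients s, ..., s+N; the third makes each of them nonzero. Shift and cut allow use both for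
    a whole message and for an initial piece of one. *)
Lemma poly_wt_ge (u : 'rV[{poly F}]_k) s N :
  (forall i, (i < s)%N -> coefv i u = 0) ->
  (forall i, (N < i <= N + m)%N -> coefv (s + i) u = 0) ->
  (forall t, (t <= N + m)%N ->
     exists2 i, (t - m <= i <= minn t N)%N & coefv (s + i) u != 0) ->
  (Dbound d m N <= poly_wt (u *m Gz))%N.
Proof.
move=> u_lo u_hi u_win; rewrite DboundE.
apply: leq_trans (sum_wt_le _ s (N + m).+1); apply: leq_sum => t _.
have tNm : (t <= N + m)%N by rewrite -ltnS ltn_ord.
apply: (@wt_ge (t - N)); first by lia.
  have [i iP ui] := u_win t tNm.
  apply: (@coefv_mulmx_neq0 _ _ (t - i)); [lia|lia|].
  by rewrite (_ : (s + t - (t - i) = s + i)%N) //; lia.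
rewrite coefv_mulmx; apply: summx_sub => nu _.
have nu_m := ltn_ord nu.
(* A block outside this range meets a message coefficient above s+N, zero by [u_hi], or below s,
   zero by [u_lo]. *)
have [nuP|nuP] := boolP ((t - N <= nu) && (nu <= t))%N.
  apply: submx_trans (submxMl _ _) _.
  rewrite (big_rem (nu : nat)) ?addsmx_sub ?mem_index_iota //=; last by lia.
  by apply: submx_trans (addsmxSl _ _); rewrite genmxE.
rewrite (_ : (if _ then _ else _) = 0) ?mul0mx ?sub0mx //.
case: leqP => // le_nu; have [ltnut|] := leqP nu t.
  by rewrite -addnBA // u_hi //; lia.
by move=> lt_t_nu; apply: u_lo; lia.
Qed.

Lemma ext_row_dist_ge j : (m + 1 <= j)%N ->
  (Dbound d m (j - m - 1) <= ext_row_dist m Gz j)%N.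
Proof.
move=> mj; apply: minnat_ge => [|w [u [u0 su u_win <-]]].
  (* A message without zero coefficients is admissible, so the minimum is not the default 0. *)
  pose u : 'rV[{poly F}]_k := const_mx (\poly_(i < j - m) 1).
  have i0 := Ordinal k_gt0.
  have uN0 i : (i < j - m)%N -> coefv i u != 0.
    move=> ij; apply/eqP => /rowP/(_ i0); rewrite !mxE /= coef_poly ij.
    by apply/eqP/oner_neq0.
  exists (poly_wt (u *m Gz)), u; split=> //; first by apply: uN0; lia.
    rewrite /sizev (eq_bigr (fun=> (j - m)%N)) => [|i _].
      rewrite big_const card_ord; case: (k) k_gt0 => // k' _.
      by elim: k' => /= [|k' ->]; rewrite ?maxn0 ?maxnn.
    by rewrite mxE size_poly_eq ?oner_neq0.
  by move=> i im; exists 0%N => //; apply: uN0; lia.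
apply: (@poly_wt_ge u 0) => // [i iP|t tN].
  by rewrite coefv_eq0 // su; lia.
have uN : coefv (j - m - 1) u != 0 by apply: coefv_lead; lia.
(* Early windows contain u_0, middle ones a full run of m coefficients, and late ones the leading
   coefficient. *)
have [tm|mt] := leqP t m; first by exists 0%N => //; lia.
have [tjm|tjm] := leqP t (j - m).
  have [|l lm ul] := u_win (t - m)%N; first by lia.
  by exists (t - m + l)%N => //; lia.
by exists (j - m - 1)%N => //; lia.
Qed.

(* Cut a message after its first run of [m] zero coefficients: the part of the
   codeword produced before the cut only depends on the part before the run. *)
Lemma dist_conv_code_ge :
  (\big[minn/Dbound d m 0]_(t < m.+1) Dbound d m t <=
     dist (@poly_wt F n) (conv_code Gz))%N.
Proof.
have uG0 (u : 'rV[{poly F}]_k) : u != 0 -> u *m Gz != 0.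
  move=> /coefv_neq0[j uj]; apply/eqP => uG.
  have := @coefv_mulmx_neq0 u j 0; rewrite uG subn0.
  move=> /(_ isT isT uj) /eqP; case.
  by apply/rowP => i; rewrite !mxE raddf0.
apply: minnat_ge => [|w [v [[u ->] uG <-]]].
  exists (poly_wt ((const_mx 1 : 'rV_k) *m Gz)), (const_mx 1 *m Gz).
  split=> //; first by exists (const_mx 1).
  apply: uG0; apply/eqP => /rowP/(_ (Ordinal k_gt0)); rewrite !mxE.
  by apply/eqP/oner_neq0.
have exs : exists s, coefv s u != 0.
  by apply: coefv_neq0; apply: contraNneq uG => ->; rewrite mul0mx.
case: (ex_minnP exs) => s us s_min.
pose zero_run N := [forall i : 'I_m, coefv (s + (N.+1 + i)) u == 0].
have exN : exists N, zero_run N.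
  by exists (sizev u); apply/forallP => i; rewrite coefv_eq0 //; lia.
case: (ex_minnP exN) => N /forallP runN N_min.
have u_hi i : (N < i <= N + m)%N -> coefv (s + i) u = 0.
  move=> iP; have iNm : (i - N.+1 < m)%N by lia.
  have /eqP := runN (Ordinal iNm); congr (coefv (s + _) u = 0) => /=; lia.
have wtN : (Dbound d m N <= poly_wt (u *m Gz))%N.
  apply: (@poly_wt_ge u s N) => // [i|t tN].
    by apply: contraTeq => /s_min; rewrite -leqNgt.
  have [tm|mt] := leqP t m; first by exists 0%N; [lia | rewrite addn0].
  (* An all-zero window would give a zero run at t-m-1 < N, against the minimality of [N]. *)
  apply: contrapT => noi.
  suff /N_min : zero_run (t - m.+1)%N by lia.
  apply/forallP => l; apply: contraT => ul; case: noi.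
  have lm := ltn_ord l.
  exists ((t - m.+1).+1 + l)%N => //.
  have : ~~ (N < (t - m.+1).+1 + l <= N + m)%N.
    by apply: contraNN ul => /u_hi ->.
  lia.
apply: leq_trans wtN; have [Nm|mN] := leqP N m.
  have Nm1 : (N < m.+1)%N by [].
  exact: (bigminn_le _ (fun t : 'I_m.+1 => Dbound d m t)
    (mem_index_enum (Ordinal Nm1))).
(* For N > m, D(m) <= D(N): they differ only in the factor of d_m, which is 1 and N-m+1
   respectively. *)
apply: leq_trans (bigminn_le _ (fun t : 'I_m.+1 => Dbound d m t)
  (mem_index_enum (@ord_max m))) _.
rewrite /Dbound /= leqnn (leqNgt N) mN /= leq_add2l subnn leq_mul2r.
by apply/orP; right; lia.
Qed.

End ConvolutionalBounds.

(** * Products of distinct monic irreducible polynomials *)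

Lemma monic_irreducible_coprime (F : fieldType) (p q : {poly F}) :
  irreducible_poly p -> irreducible_poly q -> p \is monic -> q \is monic ->
  p != q -> coprimep p q.
Proof.
move=> [_ ip] [_ iq] mp mq; apply: contraNT => npq.
rewrite -eqp_monic // (eqp_trans (y := gcdp p q)) //.
  by rewrite eqp_sym ip ?dvdp_gcdl.
by rewrite iq ?dvdp_gcdr.
Qed.

Lemma prod_irreducible_dvdp (F : fieldType) (I : finType) (pi : I -> {poly F})
    (g : {poly F}) :
  (forall j, irreducible_poly (pi j) /\ pi j \is monic) -> injective pi ->
  (forall j, pi j %| g) -> \prod_j pi j %| g.
Proof.
move=> piP pi_inj pig; have := index_enum_uniq I.
elim: (index_enum I) => [|j r IHr] /=; first by rewrite big_nil dvd1p.
case/andP=> jr /IHr rg; rewrite big_cons Gauss_dvdp ?pig //.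
rewrite big_seq; apply: (big_ind (coprimep (pi j))) => [|p q|i ir].
- exact: coprimep1.
- by rewrite coprimepMr => -> ->.
have [[ij mj] [ii mi]] := (piP j, piP i).
apply: monic_irreducible_coprime => //; rewrite (inj_eq pi_inj).
by apply: contraNneq jr => ->.
Qed.

(** * Idempotents, ideals and automorphisms of the cyclic algebra *)

Section CyclicAlgebra.
Variables (F : finFieldType) (n : nat).
Hypothesis n_gt0 : (0 < n)%N.
Local Notation A := (cyclic_alg F n).
Local Notation h := ('X^n - 1 : {poly F}).

(** The quotient type reduces modulo [mk_monic h]; positivity of n rules out its default value. *)
Lemma mk_monic_Xn_sub_1 : mk_monic h = h.
Proof. by rewrite /mk_monic monicXnsubC // size_XnsubC // ltnS n_gt0. Qed.

Lemma in_qpoly_dvdp (p : {poly F}) : h %| p -> in_qpoly h p = 0.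
Proof.
case/dvdpP => q ->; rewrite rmorphM /= (_ : in_qpoly h h = 0) ?mulr0 //.
apply: val_inj; rewrite /= mk_monic_Xn_sub_1.
by rewrite Pdiv.RingMonic.rmodpp ?monicXnsubC.
Qed.

Lemma in_qpoly_val (a : A) : in_qpoly h a = a.
Proof. exact/val_inj/in_qpoly_small/size_mk_monic. Qed.

Lemma in_qpoly_mul_val (a b : A) :
  in_qpoly h ((a : {poly F}) * (b : {poly F})) = a * b.
Proof. by rewrite rmorphM /= !in_qpoly_val. Qed.

Lemma qpoly_val_dvdp (p : {poly F}) : in_qpoly h p = 0 -> h %| p.
Proof.
move=> /(congr1 val) /=; rewrite mk_monic_Xn_sub_1 => /eqP.
by rewrite -/(Pdiv.CommonRing.rdvdp _ _) -Pdiv.Idomain.dvdpE.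
Qed.

Lemma coef_vec_inj : injective (@coef_vec F n).
Proof.
move=> a b /rowP ab; apply: val_inj; apply/polyP => i /=.
have sz (x : A) : (size (x : {poly F}) <= n)%N.
  rewrite -ltnS (leq_trans (size_mk_monic x)) //.
  by rewrite mk_monic_Xn_sub_1 size_XnsubC.
have [ltin|lein] := ltnP i n; first by have := ab (Ordinal ltin); rewrite !mxE.
by rewrite !nth_default // (leq_trans (sz _)).
Qed.

(** A description of primitivity without the factors of x^n-1, hence visibly stable under
    automorphisms. *)
Definition indecomposable_idempotent (e : A) :=
  [/\ e * e = e, e != 0 & forall f : A, f * f = f -> e * f = 0 \/ e * f = e].

(** Identities are checked modulo each pi_j. Since e vanishes modulo every factor but pi_i, all
    depends on whether pi_i divides f or f-1. *)
Lemma primitive_idempotentW e :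
  primitive_idempotent e -> indecomposable_idempotent e.
Proof.
case=> r [pi [i [piP pi_inj prod_pi e_pi]]].
have val_eq0 (p : {poly F}) : (forall j, pi j %| p) -> in_qpoly h p = 0.
  by move=> pip; rewrite in_qpoly_dvdp // prod_pi prod_irreducible_dvdp.
have pi_e1 : pi i %| (e : {poly F}) - 1 by have := e_pi i; rewrite eqxx.
have pi_e0 j : j != i -> pi j %| (e : {poly F}).
  by move=> ji; have := e_pi j; rewrite eq_sym (negPf ji) subr0.
have pi_n1 : ~~ (pi i %| 1).
  by rewrite dvdp1; have [[+ _] _] := piP i; case: ltngtP.
split.
- apply/eqP; rewrite -subr_eq0 -{3}(in_qpoly_val e) -in_qpoly_mul_val -rmorphB.
  apply/eqP/val_eq0 => j; rewrite -{3}[polyn e]mulr1 -mulrBr.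
  by have [->|ji] := eqVneq j i; [rewrite dvdp_mull | rewrite dvdp_mulr ?pi_e0].
- apply: contraNneq pi_n1 => e0; move: pi_e1.
  by rewrite e0 /= sub0r dvdpNr.
move=> f ff.
have : pi i %| (f : {poly F}) * ((f : {poly F}) - 1).
  apply: dvdp_trans (_ : h %| _).
    by rewrite prod_pi (bigD1 i) //= dvdp_mulr.
  apply: qpoly_val_dvdp; rewrite rmorphM rmorphB rmorph1 /= in_qpoly_val.
  by rewrite mulrBr ff mulr1 subrr.
have [pif _|npif] := boolP (pi i %| (f : {poly F})).
  left; rewrite -in_qpoly_mul_val; apply: val_eq0 => j.
  by have [->|ji] := eqVneq j i; [rewrite dvdp_mull | rewrite dvdp_mulr ?pi_e0].
have [[szi iri] mi] := piP i.
rewrite Gauss_dvdpr => [pif1|]; last first.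
  apply: contraNT npif => /iri/(_ (dvdp_gcdl _ _)).
  by rewrite eqp_sym => /eqp_dvdl ->; rewrite dvdp_gcdr.
right; apply/eqP; rewrite -subr_eq0 -{2}(in_qpoly_val e) -in_qpoly_mul_val.
rewrite -rmorphB; apply/eqP/val_eq0 => j.
rewrite -{2}[polyn e]mulr1 -mulrBr.
by have [->|ji] := eqVneq j i; [rewrite dvdp_mull | rewrite dvdp_mulr ?pi_e0].
Qed.

(** A nonzero product would equal both factors. *)
Lemma indecomposable_orthogonal e e' :
  indecomposable_idempotent e -> indecomposable_idempotent e' -> e != e' ->
  e * e' = 0.
Proof.
move=> [ee _ eP] [ee' _ eP'] ne.
case: (eP e' ee') => [//|e1]; case: (eP' e ee) => [|e2]; first by rewrite mulrC.
by case/eqP: ne; rewrite -e1 mulrC e2.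
Qed.

(* A relation [p * c = 0] with [p] of degree [e < dim <c>] would make
   [c, x c, ..., x^(e-1) c] span the ideal. *)
Lemma ideal_annihilator_size (c : A) (p : {poly F}) :
  (size p <= \dim (principal_ideal c))%N -> in_qpoly h p * c = 0 -> p = 0.
Proof.
move=> sp pc; apply/eqP; apply: contraTT sp => p0; rewrite -ltnNge.
pose X := [seq ('qX ^+ i * c : A) | i : 'I_(size p).-1].
have sizeX : size X = (size p).-1 by rewrite size_image card_ord.
suff /dimvS dX : (principal_ideal c <= <<X>>)%VS.
  apply: leq_ltn_trans (leq_trans dX (dim_span _)) _.
  by rewrite sizeX prednK // size_poly_gt0.
apply/span_subvP => _ /codomP[a ->].
(* Division by p: the multiple of p kills c, leaving a remainder of smaller degree. *)
have -> : a * c = in_qpoly h ((a : {poly F}) %% p) * c.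
  rewrite -{1}(in_qpoly_val a) {1}(divp_eq a p) rmorphD rmorphM /=.
  by rewrite mulrDl -mulrA pc mulr0 add0r.
set r := _ %% p.
have sr : (size r <= (size p).-1)%N.
  by rewrite -ltnS prednK ?ltn_modp // size_poly_gt0.
rewrite -(poly_rV_K sr) /rVpoly poly_def raddf_sum mulr_suml /=.
apply: memv_suml => i _; case: insub => [j|]; last first.
  by rewrite scale0r in_qpoly0 mul0r mem0v.
rewrite in_qpolyZ -scalerAl memvZ // memv_span //.
by apply/mapP; exists i; rewrite ?mem_enum //= rmorphXn.
Qed.

Variable sigma : {lrmorphism A -> A}.
Hypothesis sigma_bij : bijective sigma.

Lemma iter_rmorph0 nu : iter nu sigma 0 = 0.
Proof. by elim: nu => //= nu ->; rewrite rmorph0. Qed.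

Lemma iter_rmorph_sum nu (I : finType) (P : pred I) (f : I -> A) :
  iter nu sigma (\sum_(i | P i) f i) = \sum_(i | P i) iter nu sigma (f i).
Proof. by elim: nu => //= nu ->; rewrite rmorph_sum. Qed.

Lemma iter_rmorphM nu (x y : A) :
  iter nu sigma (x * y) = iter nu sigma x * iter nu sigma y.
Proof. by elim: nu => //= nu ->; rewrite rmorphM. Qed.

Lemma iter_rmorphZ nu (a : F) (x : A) :
  iter nu sigma (a *: x) = a *: iter nu sigma x.
Proof. by elim: nu => //= nu ->; rewrite linearZ. Qed.

Lemma iter_sigma_inj nu : injective (iter nu sigma).
Proof. by elim: nu => [x y|nu IHnu x y /= /(bij_inj sigma_bij)/IHnu]. Qed.

(** Test idempotents are pulled back along the inverse of [sigma]. *)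
Lemma indecomposable_sigma e :
  indecomposable_idempotent e -> indecomposable_idempotent (sigma e).
Proof.
case=> ee e0 eP; split; first by rewrite -rmorphM ee.
  by rewrite -(rmorph0 sigma) (inj_eq (bij_inj sigma_bij)).
have [tau sK tK] := sigma_bij; move=> f ff.
have tauff : tau f * tau f = tau f.
  by apply: (bij_inj sigma_bij); rewrite rmorphM /= !tK.
rewrite -[f]tK -rmorphM; case: (eP _ tauff) => ->; last by right.
by left; rewrite rmorph0.
Qed.

(** * Orthogonal shifts of c and independence of the generator blocks *)

Section OrthogonalShifts.
Variables (S : {set A}) (b : nat).
Hypothesis S_idem : forall e, e \in S -> primitive_idempotent e.
Hypothesis S_disj : forall j : nat, (1 <= j <= b)%N ->
  S :&: [set iter j sigma e | e in S] = set0.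
Let c : A := \sum_(e in S) e.
Let k := \dim (principal_ideal c).

Let S_indec e : e \in S -> indecomposable_idempotent e.
Proof. by move=> /S_idem/primitive_idempotentW. Qed.

Lemma idempotent_sum_mul e : e \in S -> c * e = e.
Proof.
move=> eS; rewrite mulr_suml (bigD1 e) //= big1 ?addr0.
  by case: (S_indec eS).
by move=> e' /andP[e'S ne]; apply: indecomposable_orthogonal => //;
  apply: S_indec.
Qed.

Lemma idempotent_sum_idem : c * c = c.
Proof.
by rewrite {2}/c mulr_sumr; apply: eq_bigr => e /idempotent_sum_mul.
Qed.

(** Every cross term pairs an element of S with one of sigma^nu(S), distinct by disjointness and
    hence orthogonal. *)
Lemma idempotent_sum_shift_mul nu : (1 <= nu <= b)%N -> c * iter nu sigma c = 0.
Proof.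
move=> nuP; rewrite iter_rmorph_sum mulr_suml big1 // => e eS.
rewrite mulr_sumr big1 // => e' e'S; apply: indecomposable_orthogonal.
- exact: S_indec.
- elim: nu {nuP} => [|nu IH] /=; first exact: S_indec.
  exact: indecomposable_sigma.
apply/eqP => ee'; have /setP/(_ e) := S_disj nuP.
by rewrite !inE eS ee' imset_f.
Qed.

Lemma idempotent_shifts_orthogonal mu nu : (mu <= b)%N -> (nu <= b)%N ->
  mu != nu -> iter mu sigma c * iter nu sigma c = 0.
Proof.
wlog ltmn : mu nu / (mu < nu)%N => [IH mub nub ne|mub nub _].
  have [lt|lt|eq] := ltngtP mu nu; first exact: IH.
    by rewrite mulrC IH // eq_sym.
  by rewrite eq eqxx in ne.
rewrite -(subnKC (ltnW ltmn)) iterD -iter_rmorphM idempotent_sum_shift_mul.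
  exact: iter_rmorph0.
by rewrite subn_gt0 ltmn (leq_trans (leq_subr _ _)).
Qed.

Lemma dim_principal_ideal_gt0 : S != set0 -> (0 < k)%N.
Proof.
case/set0Pn => e eS; rewrite lt0n dimv_eq0; apply/eqP => I0.
have: c \in principal_ideal c.
  by apply: memv_span; apply/codomP; exists 1; rewrite mul1r.
rewrite I0 memv0 => /eqP c0; have [_ /eqP[]] := S_indec eS.
by rewrite -(idempotent_sum_mul eS) c0 mul0r.
Qed.

(** Translates row combinations into multiples of c, so that independence can be settled in the
    algebra. *)
Lemma mul_gen_coef nu (w : 'rV[F]_k) :
  w *m gen_coef sigma c k nu =
    coef_vec (iter nu sigma (in_qpoly h (rVpoly w) * c)).
Proof.
rewrite /rVpoly poly_def raddf_sum mulr_suml iter_rmorph_sum.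
apply/rowP => j; rewrite mxE mxE raddf_sum coef_sum /=.
apply: eq_bigr => i _.
rewrite !mxE in_qpolyZ rmorphXn -scalerAl iter_rmorphZ coefZ.
by rewrite insubT //= => lti; congr (w _ _ * _); apply: val_inj.
Qed.

Lemma gen_coef_indep m (w : nat -> 'rV[F]_k) : (m <= b)%N ->
  \sum_(nu < m.+1) w nu *m gen_coef sigma c k nu = 0 ->
  forall nu, (nu <= m)%N -> w nu = 0.
Proof.
move=> mb w0 nu num.
pose a i := iter i sigma (in_qpoly h (rVpoly (w i)) * c).
have sum_a : \sum_(i < m.+1) a i = 0.
  apply: coef_vec_inj; rewrite (_ : coef_vec 0 = 0); last first.
    by apply/rowP => j; rewrite !mxE coef0.
  rewrite -w0; under [RHS]eq_bigr do rewrite mul_gen_coef.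
  apply/rowP => j; rewrite mxE raddf_sum coef_sum summxE.
  by under [RHS]eq_bigr do rewrite mxE.
have a_nu : a nu = 0.
  (* Multiplication by the idempotent sigma^nu(c) fixes the term [a nu] and kills all others. *)
  have := congr1 ( *%R (iter nu sigma c)) sum_a.
  have nu_lt : (nu < m.+1)%N by [].
  rewrite mulr0 mulr_sumr (bigD1 (Ordinal nu_lt)) //= big1 => [|i ne].
    by rewrite addr0 /a -iter_rmorphM mulrCA idempotent_sum_idem.
  rewrite /a iter_rmorphM mulrCA idempotent_shifts_orthogonal ?mulr0 //.
  - exact: leq_trans mb.
  - by apply: leq_trans mb; rewrite -ltnS.
  - by rewrite eq_sym.
apply: (can_inj (@rVpolyK F k)); rewrite linear0.
apply: (@ideal_annihilator_size c); first exact: size_poly.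
by apply: (@iter_sigma_inj nu); rewrite iter_rmorph0.
Qed.

End OrthogonalShifts.
End CyclicAlgebra.

(** * The distance bounds for the code generated by c *)

Theorem proposition5p1 (F : finFieldType) (n : nat)
  (n_gt0 : (0 < n)%N)
  (char_n : forall p : nat, p \in [pchar F] -> ~~ (p %| n)%N)
  (sigma : {lrmorphism cyclic_alg F n -> cyclic_alg F n})
  (sigma_bij : bijective sigma)
  (S : {set cyclic_alg F n})
  (S_idem : forall e, e \in S -> primitive_idempotent e)
  (S_neq0 : S != set0)
  (b : nat) (b_ge1 : (1 <= b)%N)
  (S_disj : forall j : nat, (1 <= j <= b)%N ->
     S :&: [set iter j sigma e | e in S] = set0)
  (c : cyclic_alg F n) (c_def : c = \sum_(e in S) e)
  (k : nat) (k_def : k = \dim (principal_ideal c))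
  (m : nat) (m_bounds : (1 <= m <= b)%N)
  (d : nat -> nat)
  (d_def : forall mu nu : nat, (mu + nu <= b)%N ->
     dist (@hamming_wt F n) (block_code sigma c k mu (mu + nu)) = d nu) :
  (forall j : nat, (m + 1 <= j)%N ->
     (Dbound d m (j - m - 1) <= ext_row_dist m (gen_mx sigma c k m) j)%N) /\
  (\big[minn/Dbound d m 0]_(t < m.+1) Dbound d m t <=
     dist (@poly_wt F n) (conv_code (gen_mx sigma c k m)))%N.
Proof.
have /andP[m_gt0 mb] := m_bounds.
have k_gt0 : (0 < k)%N by rewrite k_def c_def dim_principal_ideal_gt0.
have G_indep : forall w : nat -> 'rV[F]_k,
    \sum_(nu < m.+1) w nu *m gen_coef sigma c k nu = 0 ->
    forall nu, (nu <= m)%N -> w nu = 0.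
  by rewrite k_def c_def => w;
    apply: (gen_coef_indep n_gt0 sigma_bij S_idem S_disj).
have wt_ge mu nu (v : 'rV[F]_n) : (mu + nu <= m)%N -> v != 0 ->
    (v <= \sum_(mu <= l < (mu + nu).+1) <<gen_coef sigma c k l>>)%MS ->
    (d nu <= hamming_wt v)%N.
  move=> munu v0 vC; rewrite -(d_def _ _ (leq_trans munu mb)).
  by apply: minnat_le; exists v.
split=> [j mj|]; first exact: ext_row_dist_ge.
exact: dist_conv_code_ge.
Qed.
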